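(* Let $n\geq 3$ be an integer and let $C_n$ denote the cycle on $n$ vertices. Then $\rho(C_n)=3$ if $n\in\{3,4,6,8\}$, and $\rho(C_n)=4$ if $n\notin\{3,4,6,8\}$.
   Context: All graphs are finite, simple and undirected. A $k$-coloring of a graph $G$ is a function $c\colon V(G)\to\{1,\dots,k\}$. A walk in $G$ is a sequence $v_1\cdots v_r$ of vertices with $v_iv_{i+1}\in E(G)$ for all $i\in\{1,\dots,r-1\}$. A sequence $a_1\cdots a_{2t}$ is repetitive if $a_i=a_{i+t}$ for all $i\in\{1,\dots,t\}$. A walk $v_1\cdots v_{2t}$ is a stroll if $v_i\neq v_{i+t}$ for every $i\in\{1,\dots,t\}$. A coloring $c$ is stroll-nonrepetitive if for no stroll $v_1\cdots v_{2t}$ is the sequence $c(v_1)\cdots c(v_{2t})$ repetitive. The stroll-nonrepetitive chromatic number $\rho(G)$ is the minimum $k$ such that $G$ has a stroll-nonrepetitive $k$-coloring. *)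

(* Defs.v *)
From mathcomp Require Import all_boot.
From mathcomp Require Import boolp.

Set Implicit Arguments.
Unset Strict Implicit.
Unset Printing Implicit Defensive.

Record sgraph := SGraph {
  vertex :> finType;
  adj : rel vertex;
  adj_sym : symmetric adj;
  adj_irrefl : irreflexive adj }.

Definition walk (G : sgraph) (v : seq G) : Prop := sorted (@adj G) v.

(* The terms a_1, ..., a_2t are indexed from 0. For i < t both sides of the
   equation are of the form [Some _], because [size a = t.*2]. *)
Definition repetitive (T : Type) (t : nat) (a : seq T) : Prop :=
  size a = t.*2 /\ forall i, i < t -> onth a i = onth a (i + t).

Definition stroll (G : sgraph) (t : nat) (v : seq G) : Prop :=
  [/\ walk v, size v = t.*2 & forall i, i < t -> onth v i <> onth v (i + t)].

(* Without [0 < t] the empty walk would be a repetitive stroll for every c. *)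
Definition stroll_nonrepetitive (G : sgraph) (k : nat) (c : G -> 'I_k) : Prop :=
  forall (t : nat) (v : seq G), 0 < t -> stroll t v -> ~ repetitive t (map c v).

Definition stroll_nonrepetitive_colorable (G : sgraph) (k : nat) : Prop :=
  exists c : G -> 'I_k, stroll_nonrepetitive c.

Lemma injective_stroll_nonrepetitive (G : sgraph) (k : nat) (c : G -> 'I_k) :
  injective c -> stroll_nonrepetitive c.
Proof.
move=> c_inj t v t_gt0 [_ szv nev] [_ /(_ 0 t_gt0) eqc].
apply: (nev 0 t_gt0).
have lt_tv : t < size v by rewrite szv -addnn -[X in X < _]addn0 ltn_add2l.
have lt_0v : 0 < size v by apply: leq_ltn_trans lt_tv.
case: v lt_0v lt_tv eqc {szv nev} => // x v _ lt_tv.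
rewrite !onthE !(nth_map (c x)) ?size_map // !(nth_map x) // => /Some_inj.
by move/c_inj => ->.
Qed.

Lemma stroll_nonrepetitive_colorable_ex (G : sgraph) :
  exists k, `[< stroll_nonrepetitive_colorable G k >].
Proof.
exists #|G|; apply/asboolP; exists enum_rank.
exact/injective_stroll_nonrepetitive/enum_rank_inj.
Qed.

Definition rho (G : sgraph) : nat := ex_minn (stroll_nonrepetitive_colorable_ex G).

(* [ordS i] is i + 1 mod n. The condition [i != j] excludes a loop when n = 1
   and is redundant for n >= 2; C_n is the n-cycle for n >= 3. *)
Definition cycle_adj (n : nat) : rel 'I_n :=
  fun i j => (i != j) && ((j == ordS i) || (i == ordS j)).

Lemma cycle_adj_sym n : symmetric (@cycle_adj n).
Proof. by move=> i j; rewrite /cycle_adj eq_sym orbC. Qed.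

Lemma cycle_adj_irrefl n : irreflexive (@cycle_adj n).
Proof. by move=> i; rewrite /cycle_adj eqxx. Qed.

Definition cycle_graph (n : nat) : sgraph :=
  SGraph (@cycle_adj_sym n) (@cycle_adj_irrefl n).

(* Main.v *)
(* Upper bound.  Fold the n-cycle onto the path 0, ..., n/2 and color it by a
   word W read along that path; if n is odd, the two adjacent vertices over 0
   receive two different letters.  Suppose that W has no square and no factor
   aba, and let x and y be the projections of the two halves of a repetitive
   stroll.  If x and y ever agree, they always do, so the halves stay on
   opposite sides of the cycle and no edge joins them.  Otherwise x and y move
   in parallel or in opposite directions throughout.  Either x + y is constant,
   and then the end of x is too far from the start of y, or x - y is a nonzero
   constant d, and then the positions visited carry a square of period d.
   The word uses the paperfolding sequence f(2^k(2a+1)) = a mod 2, which has no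
   square of even period whatever the value of f(0) is: this is what allows two
   different letters at the end 0.  For n = 4, 6, 8 the word 01201 is enough.

   Lower bound.  Every 3-coloring of a path on 22 vertices repeats one of six
   short strolls, and so does every 3-coloring of each smaller cycle other than
   C_3, C_4, C_6 and C_8. *)
Require Import Defs.
From mathcomp Require Import all_boot.
From mathcomp Require Import boolp zify.

Set Implicit Arguments.
Unset Strict Implicit.
Unset Printing Implicit Defensive.

(** * Folding a cycle onto a path *)

Section Depth.
Variable n : nat.

(** [minn i (n - i)] is the distance to vertex 0, which thus lies over the far end [n./2]. Over 0
    lies one vertex if [n] is even, and both ends of the edge opposite vertex 0 if [n] is odd. *)
Definition depth i := n./2 - minn i (n - i).

Definition next_to i j :=
  [|| j == i.+1, i == j.+1, (i == 0) && (j == n.-1) | (j == 0) && (i == n.-1)].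

Lemma next_toC i j : next_to i j = next_to j i.
Proof. rewrite /next_to; lia. Qed.

Lemma depth_le i : depth i <= n./2.
Proof. exact: leq_subr. Qed.

Lemma depth_eq i j : i < n -> j < n -> depth i = depth j -> i = j \/ i + j = n.
Proof. rewrite /depth; lia. Qed.

Lemma depth_next i j : 3 < n -> i < n -> j < n -> next_to i j ->
  [\/ depth j = (depth i).+1, depth i = (depth j).+1 |
      [/\ odd n, depth i = 0, depth j = 0 & (i <= n./2) = ~~ (j <= n./2)]].
Proof.
move=> n_ge4 i_n j_n adj_ij.
have [|] := boolP [|| depth j == (depth i).+1 | depth i == (depth j).+1].
  by case/orP=> /eqP; [constructor 1 | constructor 2].
rewrite /depth /next_to in adj_ij * => ne; constructor 3; split; lia.
Qed.

Lemma depth0_next_eq i j k : 3 < n -> i < n -> j < n -> k < n -> next_to i j ->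
  next_to j k -> depth j = 1 -> depth i = 0 -> depth k = 0 -> i = k.
Proof. rewrite /depth /next_to; lia. Qed.
End Depth.

Section Fold.
(* [W true] and [W false] differ at 0 only. [Q] is meant to hold at the two ends
   of every edge of the path that carries the letters of the edge over 0 when n
   is odd: a half of a stroll using that edge is then trapped in it, since the
   letter [W _ 1] never follows on the other half. *)
Variables (n : nat) (W : bool -> nat -> nat) (Q : pred nat).
Hypothesis n_ge4 : 3 < n.
Hypothesis W_indep : forall z z' k, 0 < k -> W z k = W z' k.
Hypothesis W_proper : forall z z' k, k < n./2 -> W z k <> W z' k.+1.
Hypothesis W_apart : forall z z' k, k.+1 < n./2 -> W z k <> W z' k.+2.
Hypothesis W_square_free : forall z s d, 0 < d -> s + d.*2 <= (n./2).+1 ->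
  exists2 k, s <= k < s + d & W z k <> W z (k + d).
Let end_letter a := (a == W true 0) || (a == W false 0).
Hypothesis W_ends : odd n -> W true 0 <> W false 0.
Hypothesis Q_gt1 : forall k, Q k -> 1 < k.
Hypothesis Q_edge : odd n -> forall z z' k, k < n./2 ->
  end_letter (W z k) -> end_letter (W z' k.+1) -> Q k /\ Q k.+1.
Hypothesis Q_next : odd n -> forall z z' k k', Q k -> k' <= n./2 ->
  k' = k.+1 \/ k = k'.+1 -> W z k' <> W z' 1.

Definition fold_color i := W (i <= n./2) (depth n i).

Lemma fold_color_end i : depth n i = 0 -> end_letter (fold_color i).
Proof.
by rewrite /fold_color /end_letter => ->; case: (i <= _); rewrite eqxx ?orbT.
Qed.

Lemma depth_not_near i j : fold_color i = fold_color j ->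
  depth n i <> (depth n j).+1.
Proof.
move=> c_ij d_ij; have := depth_le n i; rewrite d_ij => lt_j.
by apply: (@W_proper (j <= n./2) (i <= n./2) _ lt_j); rewrite -d_ij.
Qed.

Lemma depth_not_near2 i j : fold_color i = fold_color j ->
  depth n i <> (depth n j).+2.
Proof.
move=> c_ij d_ij; have := depth_le n i; rewrite d_ij => lt_j.
by apply: (@W_apart (j <= n./2) (i <= n./2) _ lt_j); rewrite -d_ij.
Qed.

Lemma mirror_depth_gt0 i j : i < n -> j < n -> i <> j ->
  fold_color i = fold_color j -> depth n i = depth n j -> 0 < depth n i.
Proof.
move=> i_n j_n ne_ij; rewrite /fold_color => c_ij d_ij.
have sum_ij : i + j = n by case: (depth_eq i_n j_n d_ij).
rewrite lt0n; apply/eqP => d_i0.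
have odd_n : odd n by move: d_i0; rewrite /depth; lia.
move: c_ij; rewrite -d_ij d_i0 => c_ij; move: (W_ends odd_n).
have [i_h|i_h] := leqP i n./2; have [j_h|j_h] := leqP j n./2.
- lia.
- by rewrite i_h leqNgt j_h in c_ij; case/(_ c_ij).
- by rewrite j_h leqNgt i_h in c_ij; case/(_ (esym c_ij)).
- lia.
Qed.

(** Away from depth 0 both depths change by one, so the new ones agree or differ by two; [W_apart]
    excludes the latter. *)
Lemma mirror_next i j i' j' : i < n -> j < n -> i' < n -> j' < n ->
  next_to n i i' -> next_to n j j' ->
  i <> j -> fold_color i = fold_color j -> fold_color i' = fold_color j' ->
  depth n i = depth n j -> depth n i' = depth n j'.
Proof.
move=> i_n j_n i'_n j'_n adj_i adj_j ne_ij c_ij c_ij' d_ij.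
have d_gt0 := mirror_depth_gt0 i_n j_n ne_ij c_ij d_ij.
have nij := @depth_not_near2 i' j' c_ij'.
have nji := @depth_not_near2 j' i' (esym c_ij').
by case: (depth_next n_ge4 i_n i'_n adj_i) => [||[]];
  case: (depth_next n_ge4 j_n j'_n adj_j) => [||[]]; lia.
Qed.

(** The letter of [j'] is not [W _ 1], so [i'] cannot rise to depth 1 and the step crosses the edge
    over 0. Then [j] and [j'] carry end letters and [Q_edge] applies. *)
Lemma trapped_next i j i' j' : i < n -> j < n -> i' < n -> j' < n ->
  next_to n i i' -> next_to n j j' -> odd n ->
  fold_color i = fold_color j -> fold_color i' = fold_color j' ->
  depth n i = 0 /\ Q (depth n j) -> depth n i' = 0 /\ Q (depth n j').
Proof.
move=> i_n j_n i'_n j'_n adj_i adj_j odd_n c_ij c_ij' [d_i Qj].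
have j_gt1 := Q_gt1 Qj.
have d_j' : depth n j' = (depth n j).+1 \/ depth n j = (depth n j').+1.
  by case: (depth_next n_ge4 j_n j'_n adj_j) => [||[]]; lia.
have d_i'0 : depth n i' = 0.
  case: (depth_next n_ge4 i_n i'_n adj_i) => [d_i'||[]]; try lia.
  case: (@Q_next odd_n (j' <= n./2) (i' <= n./2) _ _ Qj (depth_le n j') d_j').
  by rewrite -d_i in d_i' *; rewrite -d_i'.
split=> //.
have e_j : end_letter (fold_color j) by rewrite -c_ij; apply: fold_color_end.
have e_j' : end_letter (fold_color j') by rewrite -c_ij'; apply: fold_color_end.
have jh := depth_le n j; have j'h := depth_le n j'.
move: e_j e_j'; rewrite /fold_color.
by case: d_j' => d_j'; rewrite d_j' => e_j e_j';
  [case: (Q_edge odd_n _ e_j e_j') | case: (Q_edge odd_n _ e_j' e_j)] => //;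
  lia.
Qed.

Lemma end_edge_trapped i j i' j' : i < n -> j < n -> i' < n -> j' < n ->
  next_to n i i' -> next_to n j j' -> odd n -> i <> j ->
  fold_color i = fold_color j -> fold_color i' = fold_color j' ->
  depth n i = 0 -> depth n i' = 0 -> depth n i = 0 /\ Q (depth n j).
Proof.
move=> i_n j_n i'_n j'_n adj_i adj_j odd_n ne_ij c_ij c_ij' d_i d_i'.
split=> //.
have e_j : end_letter (fold_color j) by rewrite -c_ij; apply: fold_color_end.
have e_j' : end_letter (fold_color j') by rewrite -c_ij'; apply: fold_color_end.
have jh := depth_le n j; have j'h := depth_le n j'.
case: (depth_next n_ge4 j_n j'_n adj_j) => [d_j'|d_j'|[_ d_j _ _]].
- by move: e_j e_j'; rewrite /fold_color d_j' => e_j e_j';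
    case: (Q_edge odd_n _ e_j e_j'); lia.
- by move: e_j e_j'; rewrite /fold_color d_j' => e_j e_j';
    case: (Q_edge odd_n _ e_j' e_j); lia.
- by have := mirror_depth_gt0 i_n j_n ne_ij c_ij; rewrite d_i d_j => /(_ erefl).
Qed.

(** Colors two steps apart reveal whether the walk turns back. At depth 0, where the side matters,
    it can only return to the same vertex. *)
Lemma fold_color_turn i j k : i < n -> j < n -> k < n ->
  next_to n i j -> next_to n j k ->
  depth n j = (depth n i).+1 \/ depth n i = (depth n j).+1 ->
  depth n k = (depth n j).+1 \/ depth n j = (depth n k).+1 ->
  depth n i = depth n k <-> fold_color i = fold_color k.
Proof.
move=> i_n j_n k_n adj_ij adj_jk s1 s2; split=> [e_ik|c_ik]; last first.
  have := @depth_not_near2 _ _ c_ik; have := @depth_not_near2 _ _ (esym c_ik).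
  by lia.
case: (posnP (depth n i)) => [i0|i_gt0].
  by rewrite (depth0_next_eq n_ge4 i_n j_n k_n) //; lia.
by rewrite /fold_color -e_ik; apply: W_indep.
Qed.

Lemma shifted_colors_contra (t : nat) (x y : nat -> nat) s d j0 :
  0 < d -> s + d.*2 <= (n./2).+1 -> j0 < t -> depth n (x j0) = s ->
  (forall j, j < t -> fold_color (x j) = fold_color (y j)) ->
  (forall j, j < t -> depth n (y j) = depth n (x j) + d) ->
  (forall k, s <= k < s + d -> exists2 j, j < t & depth n (x j) = k) ->
  False.
Proof.
move=> d_gt0 sd_h j0_t d_j0 xy_c xy_d cover.
have [k k_s] := @W_square_free (x j0 <= n./2) s d d_gt0 sd_h; apply.
have [j [j_t d_j z_j]] : exists j, [/\ j < t, depth n (x j) = k &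
    W (x j0 <= n./2) k = fold_color (x j)].
  (* Only at [k = 0] does the side matter; then [s = 0], and [x j0] itself is the vertex to take. *)
  case: (posnP k) => [k0|k_gt0].
    by exists j0; split; rewrite // /fold_color ?d_j0; [|congr W]; lia.
  have [j j_t d_j] := cover k k_s.
  by exists j; split=> //; rewrite /fold_color d_j; apply: W_indep.
rewrite z_j xy_c // /fold_color xy_d // d_j.
by apply: W_indep; lia.
Qed.

Lemma spread (t : nat) (P : nat -> Prop) :
  (forall i, i.+1 < t -> P i <-> P i.+1) ->
  forall i j, i < t -> j < t -> P i -> P j.
Proof.
move=> step.
have from0 j : j < t -> P 0 <-> P j.
  elim: j => [//|j IH] j_t; have := IH (ltnW j_t); have := step _ j_t; tauto.
by move=> i j /from0 iP /from0 jP Pi; exact: (proj1 jP (proj2 iP Pi)).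
Qed.

(** * The two halves of a repetitive stroll *)

Section Walks.
Variables (t : nat) (x y : nat -> nat).
Hypothesis t_gt0 : 0 < t.
Hypothesis x_n : forall i, i < t -> x i < n.
Hypothesis y_n : forall i, i < t -> y i < n.
Hypothesis x_next : forall i, i.+1 < t -> next_to n (x i) (x i.+1).
Hypothesis y_next : forall i, i.+1 < t -> next_to n (y i) (y i.+1).
Hypothesis xy_next : next_to n (x t.-1) (y 0).
Hypothesis xy_neq : forall i, i < t -> x i <> y i.
Hypothesis xy_color : forall i, i < t -> fold_color (x i) = fold_color (y i).

Let X i := depth n (x i).
Let Y i := depth n (y i).

Lemma XY_junction : X t.-1 <= (Y 0).+1 /\ Y 0 <= (X t.-1).+1.
Proof.
have lt_t : t.-1 < t by rewrite prednK.
have := depth_next n_ge4 (x_n lt_t) (y_n t_gt0) xy_next.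
by rewrite -/(X _) -/(Y _) => -[||[]]; lia.
Qed.

Lemma XY_neq i : i < t -> X i <> Y i.
Proof.
move=> i_t XY_i.
have mir : forall j, j < t -> X j = Y j.
  move=> j j_t; apply: (@spread t (fun j => X j = Y j) _ i j i_t j_t XY_i).
  move=> k k1_t; have k_t := ltnW k1_t.
  have [kx ky] := (x_next k1_t, y_next k1_t).
  split; first by apply: mirror_next; auto.
  by rewrite next_toC in kx; rewrite next_toC in ky; apply: mirror_next; auto.
have X_gt0 : forall j, j < t -> 0 < X j.
  by move=> j j_t; apply: (@mirror_depth_gt0 _ (y j) (x_n j_t) (y_n j_t)
    (xy_neq j_t) (xy_color j_t) (mir j j_t)).
have sum_n j : j < t -> x j + y j = n.
  move=> j_t; case: (depth_eq (x_n j_t) (y_n j_t) (mir _ j_t)) => // e.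
  by case: (xy_neq j_t).
(* Changing sides would lead through vertex 0, which is its own mirror image, or through depth 0. *)
have side : forall j, j < t -> (x 0 < y 0) = (x j < y j).
  elim=> [//|j IH] j1_t; have j_t := ltnW j1_t.
  rewrite (IH j_t).
  have := sum_n _ j_t; have := sum_n _ j1_t; have := X_gt0 _ j_t.
  have := x_next j1_t; have := y_n j_t; have := y_n j1_t.
  have := X_gt0 _ j1_t.
  rewrite /X /depth /next_to; lia.
have lt_t : t.-1 < t by rewrite prednK.
have := side _ lt_t; have := sum_n _ lt_t; have := sum_n _ t_gt0.
have := X_gt0 _ lt_t; have := X_gt0 _ t_gt0; have := xy_next.
have := y_n lt_t; have := y_n t_gt0; have := x_n t_gt0; have := x_n lt_t.
rewrite /X /depth /next_to; lia.
Qed.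

(** A trap would persist at all indices, with one half at depth 0 and the other above depth 1,
    against [XY_junction]. *)
Lemma not_trapped i : i < t -> odd n ->
  ~ (X i = 0 /\ Q (Y i)) /\ ~ (Y i = 0 /\ Q (X i)).
Proof.
move=> i_t odd_n; have [XY YX] := XY_junction.
have lt_t : t.-1 < t by rewrite prednK.
split=> trap.
- have trapped j (j_t : j < t) : X j = 0 /\ Q (Y j).
    apply: (@spread t (fun j => X j = 0 /\ Q (Y j)) _ i j i_t j_t trap).
    move=> k k1_t; have k_t := ltnW k1_t.
    have [kx ky] := (x_next k1_t, y_next k1_t).
    split; first by apply: trapped_next; auto.
    rewrite next_toC in kx; rewrite next_toC in ky.
    by apply: trapped_next; auto.
  by have [Xt _] := trapped _ lt_t; have [_ /Q_gt1] := trapped _ t_gt0; lia.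
- have trapped j (j_t : j < t) : Y j = 0 /\ Q (X j).
    apply: (@spread t (fun j => Y j = 0 /\ Q (X j)) _ i j i_t j_t trap).
    move=> k k1_t; have k_t := ltnW k1_t.
    have [kx ky] := (x_next k1_t, y_next k1_t).
    have [ck ck1] := (esym (xy_color k_t), esym (xy_color k1_t)).
    split; first by apply: trapped_next; auto.
    rewrite next_toC in kx; rewrite next_toC in ky.
    by apply: trapped_next; auto.
  by have [_ /Q_gt1] := trapped _ lt_t; have [] := trapped _ t_gt0; lia.
Qed.

Lemma X_step i : i.+1 < t -> X i.+1 = (X i).+1 \/ X i = (X i.+1).+1.
Proof.
move=> i1_t; have i_t := ltnW i1_t.
case: (depth_next n_ge4 (x_n i_t) (x_n i1_t) (x_next i1_t)); auto.
case=> odd_n X_i X_i1 _; case: (not_trapped i_t odd_n) => + _; case.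
by apply: (end_edge_trapped (i' := x i.+1) (j' := y i.+1)); auto.
Qed.

Lemma Y_step i : i.+1 < t -> Y i.+1 = (Y i).+1 \/ Y i = (Y i.+1).+1.
Proof.
move=> i1_t; have i_t := ltnW i1_t.
case: (depth_next n_ge4 (y_n i_t) (y_n i1_t) (y_next i1_t)); auto.
case=> odd_n Y_i Y_i1 _; case: (not_trapped i_t odd_n) => _; case.
have ne_yx : y i <> x i := fun e => xy_neq i_t (esym e).
have [c_i c_i1] := (esym (xy_color i_t), esym (xy_color i1_t)).
by apply: (end_edge_trapped (i' := y i.+1) (j' := x i.+1)); auto.
Qed.

Lemma XY_turn i : i.+2 < t -> X i = X i.+2 <-> Y i = Y i.+2.
Proof.
move=> i2_t; have i1_t := ltnW i2_t; have i_t := ltnW i1_t.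
have eX := fold_color_turn (x_n i_t) (x_n i1_t) (x_n i2_t) (x_next i1_t)
  (x_next i2_t) (X_step i1_t) (X_step i2_t).
have eY := fold_color_turn (y_n i_t) (y_n i1_t) (y_n i2_t) (y_next i1_t)
  (y_next i2_t) (Y_step i1_t) (Y_step i2_t).
rewrite /X /Y; rewrite -!xy_color // in eY; tauto.
Qed.

Lemma XY_not_near i : i < t -> X i <> (Y i).+1 /\ Y i <> (X i).+1.
Proof.
by move=> i_t; have c := xy_color i_t; split; apply: depth_not_near.
Qed.

(** The first step decides between the two cases, and [XY_turn] preserves the choice. The induction
    carries two consecutive indices because a turn involves three. *)
Lemma XY_parallel : (forall i, i < t -> X i + Y 0 = Y i + X 0) \/
  (forall i, i < t -> X i + Y i = X 0 + Y 0).
Proof.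
have [t1|t_gt1] := leqP t 1; first by left=> -[|i]; lia.
have [e|e] : X 1 + Y 0 = Y 1 + X 0 \/ X 1 + Y 1 = X 0 + Y 0.
  by have := X_step t_gt1; have := Y_step t_gt1; lia.
- left; suff ind i : (i < t -> X i + Y 0 = Y i + X 0) /\
    (i.+1 < t -> X i.+1 + Y 0 = Y i.+1 + X 0) by move=> i; case: (ind i).
  elim: i => [|i [IH0 IH1]]; first by split; lia.
  split=> // i2_t.
  have := IH0 (ltnW (ltnW i2_t)); have := IH1 (ltnW i2_t).
  have := X_step i2_t; have := Y_step i2_t.
  have := X_step (ltnW i2_t); have := Y_step (ltnW i2_t).
  by have := XY_turn i2_t; lia.
- right; suff ind i : (i < t -> X i + Y i = X 0 + Y 0) /\
    (i.+1 < t -> X i.+1 + Y i.+1 = X 0 + Y 0) by move=> i; case: (ind i).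
  elim: i => [|i [IH0 IH1]]; first by split; lia.
  split=> // i2_t.
  have := IH0 (ltnW (ltnW i2_t)); have := IH1 (ltnW i2_t).
  have := X_step i2_t; have := Y_step i2_t.
  have := X_step (ltnW i2_t); have := Y_step (ltnW i2_t).
  by have := XY_turn i2_t; lia.
Qed.

Lemma intermediate_value (Z : nat -> nat) i :
  (forall j, j < i -> Z j.+1 = (Z j).+1 \/ Z j = (Z j.+1).+1) ->
  forall k, minn (Z 0) (Z i) <= k <= maxn (Z 0) (Z i) ->
  exists2 j, j <= i & Z j = k.
Proof.
elim: i => [|i IH] step k k_i; first by exists 0; lia.
have [k_i1|k_i1] := eqVneq (Z i.+1) k; first by exists i.+1.
have [||j j_i e] := IH _ k; last by exists j => //; apply: leqW.
  by move=> j j_i; apply: step; apply: ltnW.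
by have := step i (ltnSn i); lia.
Qed.

Lemma fold_walks_contra : False.
Proof.
have lt_t : t.-1 < t by rewrite prednK.
have [XY YX] := XY_junction.
have := XY_neq t_gt0; have [n1 n2] := XY_not_near t_gt0 => ne.
case: XY_parallel => [diff|sum]; last first.
  (* [X] and [Y] stay at least two apart, so their order never changes. As their sum is constant,
     [X t.-1] and [Y 0] lie on opposite sides of half the sum, too far apart for the junction. *)
  have side i : i < t -> (X 0 < Y 0) = (X i < Y i).
    elim: i => [//|i IH] i1_t; have i_t := ltnW i1_t.
    have := XY_neq i_t; have := XY_neq i1_t.
    have := XY_not_near i_t; have := XY_not_near i1_t.
    have := X_step i1_t; have := IH i_t; have := sum _ i_t; have := sum _ i1_t.
    by lia.
  have := side _ lt_t; have := sum _ lt_t; have := XY_neq lt_t.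
  by have := XY_not_near lt_t; lia.
have dt := diff _ lt_t.
have stepX j : j < t.-1 -> X j.+1 = (X j).+1 \/ X j = (X j.+1).+1.
  by move=> j_t; apply: X_step; lia.
have stepY j : j < t.-1 -> Y j.+1 = (Y j).+1 \/ Y j = (Y j.+1).+1.
  by move=> j_t; apply: Y_step; lia.
have bXt : X t.-1 <= n./2 := depth_le n _.
have bYt : Y t.-1 <= n./2 := depth_le n _.
have bX0 : X 0 <= n./2 := depth_le n _.
have bY0 : Y 0 <= n./2 := depth_le n _.
(* With [d] the constant distance, the junction forces the lower half to sweep [d] consecutive
   depths, which start a square of period [d]. *)
have [lt|gt] := ltnP (X 0) (Y 0).
- apply: (@shifted_colors_contra t x y (X 0) (Y 0 - X 0) 0) => //; try lia.
  + by move=> j j_t; have := diff _ j_t; rewrite -/(X j) -/(Y j); lia.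
  + move=> k k_s; have [|j j_t e] := intermediate_value stepX (k := k).
      by lia.
    by exists j => //; lia.
(* Now [y] is the lower half. It starts at the top of the swept depths, so [j0] is found as an index
   at which it visits the least of them. *)
- have [|j0 j0_t e0] := intermediate_value stepY (k := (Y 0).+1 - (X 0 - Y 0)).
    by lia.
  apply: (@shifted_colors_contra t y x _ (X 0 - Y 0) j0 _ _ _ e0); try lia.
  + by move=> j j_t; rewrite xy_color.
  + by move=> j j_t; have := diff _ j_t; rewrite -/(X j) -/(Y j); lia.
  + move=> k k_s; have [|j j_t e] := intermediate_value stepY (k := k).
      by lia.
    by exists j => //; lia.
Qed.
End Walks.
End Fold.

(** * Strolls in the cycle as sequences of indices *)

Lemma cycle_adj_next_to n (i j : 'I_n) : cycle_adj i j -> next_to n i j.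
Proof.
case: n i j => [[]//|n] i j.
have ordSE (k : 'I_n.+1) : ordS k = (if k == n :> nat then 0 else k.+1) :> nat.
  rewrite /=; case: eqP => [->|/eqP k_n]; first by rewrite modnn.
  by rewrite modn_small // ltnS ltn_neqAle k_n -ltnS ltn_ord.
rewrite /cycle_adj /next_to -!val_eqE -![val _]/(nat_of_ord _) !ordSE.
by have := ltn_ord i; have := ltn_ord j; case: ifP; case: ifP; lia.
Qed.

Lemma onth_size_nth (T : Type) (x0 : T) (s : seq T) i :
  i < size s -> onth s i = Some (nth x0 s i).
Proof. by move=> i_s; rewrite onthE (nth_map x0). Qed.

Lemma fold_stroll_nonrepetitive n (W : bool -> nat -> nat) (Q : pred nat) K :
  3 < n ->
  (forall z z' k, 0 < k -> W z k = W z' k) ->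
  (forall z z' k, k < n./2 -> W z k <> W z' k.+1) ->
  (forall z z' k, k.+1 < n./2 -> W z k <> W z' k.+2) ->
  (forall z s d, 0 < d -> s + d.*2 <= (n./2).+1 ->
    exists2 k, s <= k < s + d & W z k <> W z (k + d)) ->
  (odd n -> W true 0 <> W false 0) ->
  (forall k, Q k -> 1 < k) ->
  (odd n -> forall z z' k, k < n./2 ->
    (W z k == W true 0) || (W z k == W false 0) ->
    (W z' k.+1 == W true 0) || (W z' k.+1 == W false 0) -> Q k /\ Q k.+1) ->
  (odd n -> forall z z' k k', Q k -> k' <= n./2 ->
    k' = k.+1 \/ k = k'.+1 -> W z k' <> W z' 1) ->
  (forall z k, W z k <= K) ->
  stroll_nonrepetitive
    (fun i : cycle_graph n => inord (fold_color n W i) : 'I_K.+1).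
Proof.
move=> n_ge4 W_indep W_proper W_apart W_sqf W_ends Q_gt1 Q_edge Q_next W_K.
move=> t v t_gt0 [v_walk v_size v_neq] [_ v_rep].
have [v0] : exists v0 : cycle_graph n, True.
  case: v {v_walk v_neq v_rep} v_size => [|v0 v] /= v_size; first by lia.
  by exists v0.
move=> _; pose x i := nat_of_ord (nth v0 v i).
have adj_x i : i.+1 < t.*2 -> next_to n (x i) (x i.+1).
  rewrite -v_size => i_v; apply: cycle_adj_next_to.
  exact: (sortedP _ v_walk).
apply: (fold_walks_contra n_ge4 W_indep W_proper W_apart W_sqf W_ends Q_gt1
  Q_edge Q_next (t := t) (x := x) (y := fun i => x (i + t))) => //.
all: try by move=> *; apply: ltn_ord.
- by move=> i i_t; apply: adj_x; lia.
- by move=> i i_t; rewrite addSn; apply: adj_x; lia.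
- have -> : x (0 + t) = x (t.-1).+1 by rewrite prednK.
  by apply: adj_x; lia.
- move=> i i_t e; apply: (v_neq i i_t).
  by rewrite !(onth_size_nth v0) ?v_size; [congr Some; apply: val_inj|lia|lia].
- move=> i i_t; have := v_rep i i_t.
  have [i_v it_v] : i < size v /\ i + t < size v by lia.
  rewrite !(onth_size_nth (inord 0)) ?size_map // !(nth_map v0) //.
  move=> [/(congr1 val)] /=.
  by rewrite !inordK // ltnS; apply: W_K.
Qed.
(** * A square-free word built from the paperfolding sequence *)

Definition paperfold m := odd (m %/ 2 ^ (logn 2 m).+1).

Lemma paperfoldE k a : paperfold (2 ^ k * a.*2.+1) = odd a.
Proof.
have log_k : logn 2 (2 ^ k * a.*2.+1) = k.
  rewrite lognM ?expn_gt0 // pfactorK // lognE /= dvdn2 /= odd_double /=.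
  by rewrite addn0.
rewrite /paperfold log_k expnSr divnMA mulKn ?expn_gt0 //.
by congr odd; lia.
Qed.

(** The shift adds the odd number [u.*2.+1] to [b] and so flips its parity. *)
Lemma paperfold_shift k u b :
  paperfold (2 ^ k * b.*2.+1 + 2 ^ k.+1 * u.*2.+1) =
  ~~ paperfold (2 ^ k * b.*2.+1).
Proof.
rewrite (_ : _ + _ = 2 ^ k * (b + u.*2.+1).*2.+1); last by rewrite expnS; nia.
by rewrite !paperfoldE; lia.
Qed.

Definition bit_letter (b : bool) := 2 + b.

(** Blocks over the pattern 2 0 1 2 2 1 0 2 1, where each 2 may become 3. The pattern excludes
    periods [d > 1] not divisible by 9; place 3 excludes odd multiples of 9, and the paperfolding
    letter at place 0 even ones. Place 4 complements place 3 to keep neighbors distinct; place 7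
    complements the next block's first letter to avoid a factor [aba]. *)
Definition fold_word (z : bool) i :=
  let q := i %/ 9 in
  nth 0 [:: bit_letter (if q == 0 then z else paperfold q); 0; 1;
    bit_letter (odd q); bit_letter (~~ odd q); 1; 0;
    bit_letter (~~ paperfold q.+1); 1] (i %% 9).

Lemma fold_word_block z q r : r < 9 -> fold_word z (q * 9 + r) =
  nth 0 [:: bit_letter (if q == 0 then z else paperfold q); 0; 1;
    bit_letter (odd q); bit_letter (~~ odd q); 1; 0;
    bit_letter (~~ paperfold q.+1); 1] r.
Proof.
move=> r9; rewrite /fold_word divnMDl // divn_small // addn0.
by rewrite modnMDl modn_small.
Qed.

Lemma fold_word_indep z z' i : 0 < i -> fold_word z i = fold_word z' i.
Proof.
rewrite {1}(divn_eq i 9) /fold_word; case: eqP => // -> /=.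
by case: (i %% 9).
Qed.

Lemma divn9P i : exists q r, i = q * 9 + r /\ r < 9.
Proof.
by exists (i %/ 9), (i %% 9); split; [apply: divn_eq | apply: ltn_pmod].
Qed.

Lemma fold_word_proper z z' i : fold_word z i <> fold_word z' i.+1.
Proof.
have [q [r [-> r9]]] := divn9P i; rewrite -addnS fold_word_block //.
have [r8|r8] := boolP (r.+1 < 9).
  rewrite fold_word_block //.
  by case: r r8 {r9} => [|[|[|[|[|[|[|[|]]]]]]]] //= _; case: odd.
rewrite (_ : q * 9 + r.+1 = q.+1 * 9 + 0); last by lia.
by rewrite fold_word_block // (_ : r = 8) //; lia.
Qed.

Lemma fold_word_apart z z' i : fold_word z i <> fold_word z' i.+2.
Proof.
have [q [r [-> r9]]] := divn9P i; rewrite -!addnS fold_word_block //.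
have [r8|r8] := boolP (r.+2 < 9).
  rewrite fold_word_block //.
  by case: r r8 {r9} => [|[|[|[|[|[|[|]]]]]]] //= _; case: odd.
rewrite (_ : q * 9 + r.+2 = q.+1 * 9 + (r - 7)); last by lia.
rewrite fold_word_block; last by lia.
have [->|->] : r = 7 \/ r = 8 by lia.
  by rewrite /=; case: paperfold.
by rewrite /=.
Qed.

(** The only two neighboring places at which both letters exceed 1. *)
Definition end_pos k := (k %% 9 == 3) || (k %% 9 == 4).

Lemma end_pos_gt1 k : end_pos k -> 1 < k.
Proof. by rewrite /end_pos; lia. Qed.

Lemma end_pos_edge z z' i : 1 < fold_word z i -> 1 < fold_word z' i.+1 ->
  end_pos i /\ end_pos i.+1.
Proof.
have [q [r [-> r9]]] := divn9P i; rewrite -!addnS fold_word_block //.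
have [r8|r8] := boolP (r.+1 < 9).
  rewrite fold_word_block // /end_pos !modnMDl.
  by case: r r8 {r9} => [|[|[|[|[|[|[|[|]]]]]]]].
by rewrite (_ : r = 8) //; lia.
Qed.

(** Places 2 to 5 of a block carry no 0, which is the letter at position 1. *)
Lemma end_pos_next z z' i j : end_pos i -> j = i.+1 \/ i = j.+1 ->
  fold_word z j <> fold_word z' 1.
Proof.
have [q [r [-> r9]]] := divn9P i; rewrite /end_pos modnMDl modn_small //.
move=> r34; have -> : fold_word z' 1 = 0 by [].
case=> e; have {e} :
  [\/ j = q * 9 + 2, j = q * 9 + 3, j = q * 9 + 4 | j = q * 9 + 5].
- by case/orP: r34 => /eqP e'; [constructor 3 | constructor 4]; lia.
- by case=> ->; rewrite fold_word_block.
- by case/orP: r34 => /eqP e'; [constructor 1 | constructor 2]; lia.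
- by case=> ->; rewrite fold_word_block.
Qed.

(** Identifying the letters 2 and 3 makes [fold_word] periodic. *)
Definition class_pattern i := nth 0 [:: 2; 0; 1; 2; 2; 1; 0; 2; 1] (i %% 9).

Lemma fold_word_class z i : minn 2 (fold_word z i) = class_pattern i.
Proof.
have [q [r [-> r9]]] := divn9P i; rewrite fold_word_block // /class_pattern.
rewrite modnMDl modn_small //.
by case: r r9 => [|[|[|[|[|[|[|[|[|]]]]]]]]] //= _; rewrite /bit_letter; lia.
Qed.

(** A finite check. For [r = 1] one place is not enough, as places 3 and 4 agree; three are
    available because a period congruent to 1 modulo 9, other than 1, is at least 10. *)
Lemma class_pattern_shift s r : s < 9 -> 0 < r < 9 ->
  has (fun i => class_pattern (s + i) != class_pattern (s + i + r))
    (iota 0 (if r == 1 then 3 else r)).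
Proof.
have: all (fun s => all (fun r =>
   has (fun i => class_pattern (s + i) != class_pattern (s + i + r))
    (iota 0 (if r == 1 then 3 else r))) (iota 1 8)) (iota 0 9) by [].
move=> /allP ok s9 r9; have /ok/allP : s \in iota 0 9 by rewrite mem_iota.
by apply; rewrite mem_iota.
Qed.

Lemma fold_word_square_free z s d : 0 < d ->
  exists2 k, s <= k < s + d & fold_word z k <> fold_word z (k + d).
Proof.
move=> d_gt0; have [d1|d_neq1] := eqVneq d 1.
  by exists s; rewrite ?d1 ?addn1 ?leqnn //; apply: fold_word_proper.
have [d9|d9] := boolP (9 %| d); last first.
  have /hasP [i] : has (fun i => class_pattern (s %% 9 + i) !=
      class_pattern (s %% 9 + i + d %% 9))
      (iota 0 (if d %% 9 == 1 then 3 else d %% 9)).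
    by apply: class_pattern_shift; rewrite ?ltn_pmod // lt0n d9.
  rewrite mem_iota add0n => /= i_lt ne; exists (s + i).
    rewrite leq_addr ltn_add2l /=; apply: leq_trans i_lt _.
    by case: eqP; lia.
  move=> e; case/eqP: ne; move/(congr1 (minn 2)): e; rewrite !fold_word_class.
  have -> : class_pattern (s %% 9 + i + d %% 9) = class_pattern (s + i + d).
    by rewrite /class_pattern modnDmr -!addnA modnDml.
  have -> // : class_pattern (s %% 9 + i) = class_pattern (s + i).
  by rewrite /class_pattern modnDml.
case/dvdnP: d9 d_gt0 d_neq1 => e -> e_gt0 _.
have [odd_e|even_e] := boolP (odd e).
  (* Nine consecutive positions contain a place 3, whose letter records the parity of the block
     number; adding an odd [e] flips it. *)
  have [q q_s] : exists q, s <= q * 9 + 3 < s + 9 by exists ((s + 5) %/ 9); lia.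
  exists (q * 9 + 3); first by nia.
  rewrite addnAC -mulnDl !fold_word_block //= oddD odd_e addbT.
  by case: odd.
have [k [u e_ku]] : exists k u, e = 2 ^ k.+1 * u.*2.+1.
  have [|u odd_u e_u] := @pfactor_coprime 2 e isT; first by lia.
  exists (logn 2 e).-1, u./2; rewrite prednK.
    by rewrite {1}e_u mulnC; congr (_ * _); move: odd_u; rewrite coprime2n; lia.
  by rewrite -pfactor_dvdn // ?dvdn2 //; lia.
(* [f (m + e) = ~~ f m] whenever [m] is an odd multiple of [2 ^ k], and such an
   [m] occurs among any [2 ^ k.+1] consecutive integers. *)
pose p := 2 ^ k; have p_gt0 : 0 < p by rewrite expn_gt0.
have [b b_s] : exists b, s <= p * b.*2.+1 * 9 < s + e * 9.
  (* The least [b] whose candidate is at least [s], by a division rounded up. Candidates are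
     [18 * p] apart, and [e * 9] is at least that. *)
  exists ((s + (9 * p).-1) %/ (18 * p)); rewrite e_ku expnS -/p.
  have p18 : 0 < 18 * p by lia.
  have := divn_eq (s + (9 * p).-1) (18 * p).
  have := ltn_pmod (s + (9 * p).-1) p18.
  by move: (_ %% _) (_ %/ _) => c b; nia.
exists (p * b.*2.+1 * 9 + 0); first by nia.
rewrite -addnA addn0 -mulnDl -[_ * 9]addn0 -[(_ + e) * 9]addn0.
rewrite !fold_word_block //= !ifN; try nia.
by rewrite e_ku paperfold_shift; case: paperfold.
Qed.

Lemma fold_word_le3 z i : fold_word z i <= 3.
Proof.
have [q [r [-> r9]]] := divn9P i; rewrite fold_word_block //.
have bit_le3 b : bit_letter b <= 3 by case: b.
by case: r r9 => [|[|[|[|[|[|[|[|[|]]]]]]]]] //= _; apply: bit_le3.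
Qed.
(** * Too few colors *)

(** Walks on the integer line; reduction modulo [n] turns them into walks in [C_n], so one shape
    serves for all [n]. *)
Definition zigzag (s : seq nat) :=
  sorted (fun a b => (b == a.+1) || (a == b.+1)) s.

(** With equality of colors as [r] this expresses repetitiveness, with [!=] on vertices the stroll
    condition. *)
Definition halves_agree (r : rel nat) (s : seq nat) :=
  let t := (size s)./2 in
  all (fun i => r (nth 0 s i) (nth 0 s (i + t))) (iota 0 t).

Lemma eq_halves_agree (r r' : rel nat) (s s' : seq nat) : size s = size s' ->
  (forall i j, i < size s' -> j < size s' ->
    r (nth 0 s i) (nth 0 s j) = r' (nth 0 s' i) (nth 0 s' j)) ->
  halves_agree r s = halves_agree r' s'.
Proof.
move=> size_s eq_r; rewrite /halves_agree size_s; apply: eq_in_all.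
by move=> /= i; rewrite mem_iota => /andP [_ i_s]; apply: eq_r; move: i_s; lia.
Qed.

Lemma sub_halves_agree (r r' : rel nat) s :
  (forall a b, r a b -> r' a b) -> halves_agree r s -> halves_agree r' s.
Proof. by move=> rr'; apply: sub_all => i; apply: rr'. Qed.

Lemma nonrepetitive_zigzag n k (c : cycle_graph n.+2 -> 'I_k) (s : seq nat) :
  stroll_nonrepetitive c -> zigzag s -> s != [::] -> ~~ odd (size s) ->
  halves_agree (fun a b => a %% n.+2 != b %% n.+2) s ->
  halves_agree (fun a b => c (inord (a %% n.+2)) == c (inord (b %% n.+2))) s ->
  False.
Proof.
move=> c_nonrep s_zig s_neq0 s_even /allP s_neq /allP s_rep.
pose v : seq (cycle_graph n.+2) := [seq inord (a %% n.+2) | a <- s].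
have size_s : size s = (size s)./2.*2 by lia.
have s_gt0 : 0 < size s by rewrite lt0n size_eq0.
have t_gt0 : 0 < (size s)./2 by lia.
have half i : i < (size s)./2 -> i \in iota 0 (size s)./2 by rewrite mem_iota.
have nth_v i : i < size s -> onth v i = Some (inord (nth 0 s i %% n.+2)).
  move=> i_s; rewrite (onth_size_nth (inord 0)) ?size_map //.
  by rewrite (nth_map 0).
apply: (c_nonrep (size s)./2 v t_gt0); split.
- rewrite /walk sorted_map; apply: sub_sorted s_zig => a b /= ab.
  have next m : @cycle_adj n.+2 (inord (m %% n.+2)) (inord (m.+1 %% n.+2)).
    rewrite /cycle_adj -!val_eqE /= !inordK ?ltn_pmod //.
    rewrite -[(m %% _).+1]addn1 modnDml addn1 eqxx /= andbT.
    have := eqn_modDl m 0 1 n.+2; rewrite addn0 addn1 => ->.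
    by rewrite !modn_small.
  by case/orP: ab => /eqP ->; [|rewrite cycle_adj_sym]; apply: next.
- by rewrite size_map.
- move=> i i_t; rewrite !nth_v; try lia.
  case=> /(congr1 val); rewrite /= !inordK ?ltn_pmod // => e.
  by have := s_neq _ (half _ i_t); rewrite e eqxx.
- by rewrite !size_map.
- move=> i i_t.
  rewrite !(onth_size_nth (c (inord 0))) ?size_map; try lia.
  rewrite !(nth_map (inord 0 : cycle_graph n.+2)) ?size_map; try lia.
  rewrite !(nth_map 0); try lia.
  by congr Some; apply/eqP; apply: s_rep; apply: half.
Qed.

(* Found by a greedy computer search for shortest repetitive strolls. *)
Definition stroll_shapes : seq (seq nat) :=
  [:: [:: 0; 1]; [:: 0; 1; 2; 3]; [:: 0; 1; 2; 3; 4; 5];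
      [:: 0; 1; 2; 3; 4; 5; 6; 5];
      [:: 0; 1; 2; 3; 4; 5; 6; 7; 8; 9; 8; 7];
      [:: 0; 1; 2; 3; 4; 5; 6; 7; 8; 9; 10; 11; 12; 11; 10; 9]].

(** * Exhaustive search over colorings *)

Definition width (s : seq nat) := (foldr maxn 0 s).+1.

Definition repeats_at (c : nat -> nat) o (s : seq nat) :=
  halves_agree (fun a b => c (o + a) == c (o + b)) s.

(** Occurrences that end earlier were already tested on shorter prefixes. *)
Definition ends_with_shape (w : seq nat) :=
  has (fun s => (width s <= size w) &&
    repeats_at (nth 0 w) (size w - width s) s) stroll_shapes.

(* A conditional rather than [||], which [vm_compute] evaluates eagerly. *)
Fixpoint exhausted (K : nat) (leaf : pred (seq nat)) fuel (w : seq nat) :=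
  if ends_with_shape w then true
  else if fuel is fuel'.+1 then
       all (fun a => exhausted K leaf fuel' (rcons w a)) (iota 0 K)
     else leaf w.

(** The test for a completely colored cycle: a shape may wrap around, so it must first be checked to
    remain a stroll modulo [n]. *)
Definition cyclic_repeat (w : seq nat) :=
  let n := size w in
  has (fun s => halves_agree (fun a b => a %% n != b %% n) s &&
    has (fun o => repeats_at (fun i => nth 0 w (i %% n)) o s) (iota 0 n))
  stroll_shapes.

Lemma exhausted2_path : exhausted 2 xpred0 4 [::].
Proof. by vm_compute. Qed.

Lemma exhausted2_triangle : exhausted 2 cyclic_repeat 3 [::].
Proof. by vm_compute. Qed.

Lemma exhausted3_path : exhausted 3 xpred0 22 [::].
Proof. by vm_compute. Qed.

(** The lengths run from 3 to 21; from 22 on, the path suffices. *)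
Lemma exhausted3_cycle : all (fun n => (n \in [:: 3; 4; 6; 8]) ||
  exhausted 3 cyclic_repeat n [::]) (iota 3 19).
Proof. by vm_compute. Qed.

Lemma nth_width s j : j < size s -> nth 0 s j < width s.
Proof.
rewrite /width; elim: s j => [|a s IH] [|j] //= j_s; first by lia.
by have := IH j j_s; lia.
Qed.

(** Along the branch that spells [g], the search either stops at a prefix ending with a shape or
    reaches its leaf at length [m]. *)
Lemma exhaustedP (g : nat -> nat) K leaf m : (forall i, g i < K) ->
  exhausted K leaf m [::] ->
  leaf (mkseq g m) \/
  exists s o, [/\ s \in stroll_shapes, o + width s <= m & repeats_at g o s].
Proof.
move=> g_ltK; rewrite -[[::]]/(mkseq g 0).
suff: forall f l, l + f = m -> exhausted K leaf f (mkseq g l) ->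
    leaf (mkseq g m) \/
    exists s o, [/\ s \in stroll_shapes, o + width s <= m & repeats_at g o s].
  by apply; rewrite add0n.
have shape_found f l : l + f = m ->
    ends_with_shape (mkseq g l) ->
    exists s o, [/\ s \in stroll_shapes, o + width s <= m & repeats_at g o s].
  rewrite /ends_with_shape size_mkseq => lf_m /hasP [s s_in /andP [w_s rep_s]].
  exists s, (l - width s); split=> //; first by lia.
  have bnd j : j < size s -> l - width s + nth 0 s j < l.
    by move=> j_s; have := nth_width j_s; lia.
  apply: etrans rep_s; apply: eq_halves_agree => //.
  by move=> i j i_s j_s; rewrite !nth_mkseq // bnd.
elim=> [|f IH] l lf_m; rewrite [exhausted _ _ _ _]/exhausted -/exhausted;
  case: ifP => [found _|_].
- by right; apply: (shape_found _ _ lf_m found).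
- by rewrite addn0 in lf_m; left; rewrite -lf_m.
- by right; apply: (shape_found _ _ lf_m found).
- move=> /allP exh; apply: (IH l.+1); first by rewrite -lf_m addnS.
  by rewrite mkseqS; apply: exh; rewrite mem_iota add0n g_ltK.
Qed.

Lemma exhausted_not_colorable n k K : 1 < n -> k <= K ->
  (exists2 m, m <= n & exhausted K xpred0 m [::]) \/
    exhausted K cyclic_repeat n [::] ->
  ~ stroll_nonrepetitive_colorable (cycle_graph n) k.
Proof.
case: n => [|[|n]] // _ k_leK exh [c c_nonrep].
pose g i := c (inord (i %% n.+2)) : nat.
have g_ltK i : g i < K by apply: leq_trans k_leK; apply: ltn_ord.
have no_shape s o : s \in stroll_shapes ->
    halves_agree (fun a b => a %% n.+2 != b %% n.+2) s -> ~ repeats_at g o s.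
  move=> s_in s_neq s_rep.
  have [s_zig s_neq0 s_even] : [/\ zigzag s, s != [::] & ~~ odd (size s)].
    by move: s_in; rewrite !inE; do ?case/predU1P => [->|] //; move/eqP->.
  pose s' := [seq o + a | a <- s].
  have nth_s' i : i < size s -> nth 0 s' i = o + nth 0 s i.
    exact: nth_map.
  apply: (@nonrepetitive_zigzag n k c s' c_nonrep).
  - by rewrite /zigzag sorted_map; apply: sub_sorted s_zig => a b /=; lia.
  - by rewrite -size_eq0 size_map size_eq0.
  - by rewrite size_map.
  - apply: etrans s_neq; apply: eq_halves_agree; first exact: size_map.
    by move=> i j i_s j_s; rewrite !nth_s' // eqn_modDl.
  - apply: etrans s_rep; apply: eq_halves_agree; first exact: size_map.
    by move=> i j i_s j_s; rewrite !nth_s'.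
have path_shape s o : s \in stroll_shapes -> o + width s <= n.+2 ->
    ~ repeats_at g o s.
  move=> s_in w_s; apply: no_shape => //.
  (* Corresponding entries of the halves are distinct and below [width s <= n.+2], hence distinct
     modulo [n.+2]. *)
  have : halves_agree (fun a b => (a < width s) && (b < width s) && (a != b)) s.
    by move: s_in; rewrite !inE; do ?case/predU1P => [->|] //; move/eqP->.
  apply: sub_halves_agree => a b /andP [/andP [a_w b_w] ne_ab].
  by rewrite !modn_small //; lia.
case: exh => [[m m_n]|] /(exhaustedP g_ltK) [] //.
- by case=> s [o [s_in w_s]]; apply: path_shape => //; apply: leq_trans m_n.
- rewrite /cyclic_repeat size_mkseq.
  move=> /hasP [s s_in /andP [s_neq /hasP [o _ s_rep]]].
  apply: (no_shape s o s_in s_neq); apply: sub_halves_agree s_rep => a b.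
  by rewrite !nth_mkseq ?ltn_pmod // /g !modn_mod.
- by case=> s [o [s_in w_s]]; apply: path_shape.
Qed.

Lemma cycle_not_2colorable n k : 3 <= n -> k <= 2 ->
  ~ stroll_nonrepetitive_colorable (cycle_graph n) k.
Proof.
move=> n_ge3 k_le2; apply: exhausted_not_colorable k_le2 _; first exact: ltnW.
move: n_ge3; rewrite leq_eqVlt => /predU1P [<-|n_ge4].
  by right; apply: exhausted2_triangle.
by left; exists 4; last exact: exhausted2_path.
Qed.

Lemma cycle_not_3colorable n k : 3 <= n -> n \notin [:: 3; 4; 6; 8] -> k <= 3 ->
  ~ stroll_nonrepetitive_colorable (cycle_graph n) k.
Proof.
move=> n_ge3 n_notin k_le3; apply: exhausted_not_colorable k_le3 _.
  exact: ltnW.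
have [n_ge22|n_lt22] := leqP 22 n.
  by left; exists 22; last exact: exhausted3_path.
right; have /allP/(_ n) := exhausted3_cycle.
by rewrite (negbTE n_notin) mem_iota n_ge3; apply.
Qed.

(** * The value of rho *)

Lemma cycle_4colorable n : 3 < n ->
  stroll_nonrepetitive_colorable (cycle_graph n) 4.
Proof.
move=> n_ge4; eexists.
apply: (@fold_stroll_nonrepetitive n fold_word end_pos) => //.
- exact: fold_word_indep.
- by move=> z z' k _; apply: fold_word_proper.
- by move=> z z' k _; apply: fold_word_apart.
- by move=> z s d d_gt0 _; apply: fold_word_square_free.
- exact: end_pos_gt1.
- move=> _ z z' k _ end_k end_k1.
  (* The end letters are 3 and 2. *)
  have letter_gt1 a :
      (a == fold_word true 0) || (a == fold_word false 0) -> 1 < a.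
    by case/orP=> /eqP->.
  by apply: (end_pos_edge (letter_gt1 _ end_k) (letter_gt1 _ end_k1)).
- by move=> _ z z' k k' end_k _; apply: end_pos_next.
- exact: fold_word_le3.
Qed.

(** For 4, 6 and 8 the depths are at most 4, so a square would have period 1 or 2, which [k %% 3]
    avoids. As [n] is even, a single vertex lies over 0 and [pred0] can serve as [Q]. *)
Lemma cycle_3colorable n : n \in [:: 3; 4; 6; 8] ->
  stroll_nonrepetitive_colorable (cycle_graph n) 3.
Proof.
rewrite inE => /predU1P [->|n_in].
  by exists id; apply: injective_stroll_nonrepetitive.
have [n_ge4 n_le8 n_even] : [/\ 3 < n, n <= 8 & ~~ odd n].
  by move: n_in; rewrite !inE => /or3P [] /eqP ->.
eexists; apply: (@fold_stroll_nonrepetitive n (fun _ k => k %% 3) pred0) => //.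
all: try by rewrite (negbTE n_even).
- by move=> *; lia.
- by move=> *; lia.
- by move=> z s d d_gt0 sd_le; exists s; lia.
- by move=> _ k; lia.
Qed.

Lemma rhoE (G : sgraph) k : stroll_nonrepetitive_colorable G k ->
  (forall j, j < k -> ~ stroll_nonrepetitive_colorable G j) -> rho G = k.
Proof.
move=> G_k G_lt; rewrite /rho; case: ex_minnP => m /asboolP G_m min_m.
apply/eqP; rewrite eqn_leq min_m; last exact/asboolP.
by rewrite leqNgt; apply/negP => /G_lt.
Qed.

Theorem theorem3 (n : nat) (hn : 3 <= n) :
  (n \in [:: 3; 4; 6; 8] -> rho (cycle_graph n) = 3) /\
  (n \notin [:: 3; 4; 6; 8] -> rho (cycle_graph n) = 4).
Proof.
split=> n_in; apply: rhoE.
- exact: cycle_3colorable.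
- by move=> j j_lt3; apply: cycle_not_2colorable.
- apply: cycle_4colorable; move: n_in; rewrite !inE.
  by case: eqP => // /eqP n_neq3 _; rewrite ltn_neqAle eq_sym n_neq3.
- by move=> j j_lt4; apply: cycle_not_3colorable.
Qed.
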